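(* Every connected resistance positive graph is $1$-tough.
   Context: Graphs $G=(V,E)$ are finite, simple (no multi-edges) and loopless. A spanning tree of a connected graph $G$ is a maximal acyclic subset of edges $T\subseteq E$. For edge weights $c=(c_e)_{e\in E}$ with $0<c_e<\infty$, the relative resistance of $e\in E$ is $r_e(c)=\frac{\sum_{T\ni e}\prod_{t\in T}c_t}{\sum_{T}\prod_{t\in T}c_t}$, with sums over spanning trees $T$, and the resistance curvature of $v\in V$ is $p_v(c)=1-\frac12\sum_{uv\in E}r_{uv}(c)$ (sum over edges incident to $v$). $G$ is resistance positive (RP) if there exist weights $c$ with $p_v(c)>0$ for all $v\in V$. A graph $G$ is $t$-tough if for every set of vertices $U\subset V$ whose removal disconnects the graph, the graph $G-U$ has at most $|U|/t$ connected components. *)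

(* Defs.v *)
From mathcomp Require Import all_boot all_order all_algebra.
From mathcomp Require Import boolp reals.

Set Implicit Arguments.
Unset Strict Implicit.
Unset Printing Implicit Defensive.

Import GRing.Theory Num.Theory.
Local Open Scope ring_scope.

Section Graphs.

(* A finite simple graph is a symmetric irreflexive relation [e] on a finite
   type [V]; symmetry and irreflexivity are hypotheses of the theorem. *)
Variables (V : finType) (e : rel V).

Definition edges : {set {set V}} :=
  [set [set p.1; p.2] | p : V * V & e p.1 p.2].

Definition connected : Prop := forall x y : V, connect e x y.

(* G - U, the subgraph induced on the complement of U. *)
Definition delete_vertices (U : {set V}) : rel {x : V | x \notin U} :=
  relpre val e.

Definition num_components : nat := n_comp e V.

(* For a set F of unordered pairs: no closed walk with at least three vertices,
   all of them distinct, runs along F. *)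
Definition acyclic (F : {set {set V}}) : Prop :=
  forall s : seq V, (2 < size s)%N ->
    ~ ucycle (fun x y => [set x; y] \in F) s.

Definition spanning_tree (T : {set {set V}}) : bool :=
  maxset (fun F => (F \subset edges) && `[< acyclic F >]) T.

Section Resistance.

(* Only the values of the weight function on [edges] matter. *)
Variables (R : realType) (c : {set V} -> R).

Definition relative_resistance (f : {set V}) : R :=
  (\sum_(T : {set {set V}} | spanning_tree T && (f \in T)) \prod_(t in T) c t)
  / (\sum_(T : {set {set V}} | spanning_tree T) \prod_(t in T) c t).

Definition resistance_curvature (v : V) : R :=
  1 - 2^-1 * \sum_(u | e u v) relative_resistance [set u; v].

End Resistance.

Definition resistance_positive (R : realType) : Prop :=
  exists c : {set V} -> R,
    (forall f, f \in edges -> 0 < c f) /\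
    (forall v, 0 < resistance_curvature c v).

End Graphs.

Definition tough (R : realType) (t : R) (V : finType) (e : rel V) : Prop :=
  forall U : {set V}, ~ connected (@delete_vertices V e U) ->
    (num_components (@delete_vertices V e U))%:R <= #|U|%:R / t.

(* Main.v *)
Require Import Defs.
From mathcomp Require Import all_boot all_order all_algebra.
From mathcomp Require Import boolp reals.
From mathcomp Require Import lra.

(** Draw a spanning tree [T] with probability proportional to its weight. The
    expected degree of [v] in [T] is [2 (1 - p_v)], hence less than 2 when the
    curvature is positive. Let [G - U] have [m] components, and contract each of
    them to a point. Every spanning tree becomes a connected graph on
    [#|U| + m] points, so at least [#|U| + m - 1] of its edges survive, and each
    of these has an end in [U]. Therefore [#|U| + m - 1] is at most the expected
    sum over [U] of the tree degrees, which is less than [2 #|U|] since [U] is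
    nonempty; so [m <= #|U|]. *)

Set Implicit Arguments.
Unset Strict Implicit.
Unset Printing Implicit Defensive.

Import Order.TTheory GRing.Theory Num.Theory.
Local Open Scope ring_scope.

(** * Connectedness and existence of spanning trees *)

Definition adj (V : finType) (F : {set {set V}}) : rel V :=
  fun x y => [set x; y] \in F.

Lemma adj_sym (V : finType) (F : {set {set V}}) : symmetric (adj F).
Proof. by move=> x y; rewrite /adj setUC. Qed.

Lemma set2_inj (V : finType) (a b x y : V) :
  [set a; b] = [set x; y] -> (a = x /\ b = y) \/ (a = y /\ b = x).
Proof.
move=> E.
have: a \in [set x; y] by rewrite -E set21.
have: b \in [set x; y] by rewrite -E set22.
have: x \in [set a; b] by rewrite E set21.
have: y \in [set a; b] by rewrite E set22.
rewrite !inE.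
do 4! (case/orP=> /eqP ?; subst); tauto.
Qed.

(** Supplies an edge of the graph leaving a component of a forest, and later an edge of a tree
    leaving the preimage of a set of contracted points. *)
Lemma connect_exit (V : finType) (r : rel V) (P : pred V) (x y : V) :
  connect r x y -> P x -> ~~ P y -> exists a b, [/\ r a b, P a & ~~ P b].
Proof.
case/connectP=> p; elim: p x => [|z p IH] x /=.
  by move=> _ -> ->.
case/andP=> rxz zp yE Px NPy; have [Pz|NPz] := boolP (P z); first exact: IH zp yE Pz NPy.
by exists x, z.
Qed.

(** The cycle must use the new edge. Rotated so that this edge, [x] to [y], comes first, it returns
    from [y] to [x] through a third vertex and without repetition, so the way back runs along
    [F]. *)
Lemma connect_of_new_cycle (V : finType) (F : {set {set V}}) (u v : V) (s : seq V) :
  (2 < size s)%N -> ucycle (adj ([set u; v] |: F)) s -> ~~ cycle (adj F) s ->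
  connect (adj F) u v.
Proof.
move=> s_gt2 s_cycle s_notF.
have [cs us] := andP s_cycle.
have [x xs xF] : exists2 x, x \in s & ~~ adj F x (next s x).
  apply/hasP; apply: contraNT s_notF => /hasPn H.
  by apply: cycle_from_next => // x /H; rewrite negbK.
have xyE : [set x; next s x] = [set u; v].
  have := next_cycle cs xs; rewrite /adj in xF *.
  by rewrite in_setU1 (negbTE xF) orbF => /eqP.
have [i s' sE] := rot_to xs.
have nE : next s x = next (x :: s') x by rewrite -sE next_rot.
move: s_gt2 s_cycle; rewrite -(rot_ucycle i) -(size_rot i) sE.
case: s' {sE xs} nE => [|y [|z p]] //=; rewrite eqxx => nE _.
rewrite {}nE in xyE xF.
rewrite /ucycle /= rcons_path => /andP[/and4P[_ yz zp lx]].
rewrite !inE !negb_or => /and4P[/and3P[nxy nxz xp] /andP[nyz yp] _ _].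
(* The new edge can only be traversed from [x] to [y], which the first hypothesis excludes, or from
   [y] to [x], which the second excludes. *)
have drop_edge a b : a != x -> b != x \/ a != y ->
    adj ([set u; v] |: F) a b -> adj F a b.
  move=> ax bxay; rewrite /adj in_setU1 -xyE => /orP[/eqP|//].
  case/set2_inj=> [[E _]|[E E']]; first by rewrite E eqxx in ax.
  by case: bxay; rewrite ?E ?E' eqxx.
have zpP : all (fun a => (a != x) && (a != y)) (z :: p).
  apply/allP=> a; rewrite inE => /orP[/eqP->|ap]; first by rewrite eq_sym nxz eq_sym nyz.
  by apply/andP; split; [apply: contraNneq xp|apply: contraNneq yp] => <-.
have cyx : connect (adj F) y x.
  apply/connectP; exists (z :: rcons p x); last by rewrite /= last_rcons.
  rewrite /= rcons_path drop_edge //=; last 2 first.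
  - by rewrite eq_sym.
  - by left; rewrite eq_sym.
  apply/andP; split.
    apply: sub_in_path zpP zp => a b /andP[ax ay] _; apply: drop_edge => //; by right.
  have /andP[lx' ly] := allP zpP _ (mem_last z p).
  by apply: drop_edge lx => //; right.
case: (set2_inj xyE) => [[<- <-]|[<- <-]] //.
by rewrite (sym_connect_sym (@adj_sym _ F)).
Qed.

Lemma spanning_tree_sub_edges (V : finType) (e : rel V) (T : {set {set V}}) :
  spanning_tree e T -> T \subset edges e.
Proof. by case/maxsetP=> /andP[]. Qed.

(** Otherwise some edge of [e] joins two components of [T]; adding it creates no cycle, against the
    maximality of [T]. *)
Lemma spanning_tree_connected (V : finType) (e : rel V) (T : {set {set V}}) :
  connected e -> spanning_tree e T -> connected (adj T).
Proof.
move=> e_conn /maxsetP[/andP[T_edges /asboolP T_acyclic] T_max] x y.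
apply/idPn=> nxy.
have [a [b [eab ca ncb]]] := connect_exit (e_conn x y) (connect0 (adj T) x) nxy.
have nab : ~~ connect (adj T) a b.
  by apply: contraNN ncb; apply: connect_trans.
suff abT : [set a; b] \in T by rewrite connect1 in nab.
rewrite -(T_max ([set a; b] |: T)) ?setU11 ?subsetUr //.
apply/andP; split.
  rewrite subUset T_edges sub1set andbT.
  by apply/imsetP; exists (a, b); rewrite ?inE.
apply/asboolP=> s s_gt2 s_cycle.
apply: (negP nab); apply: (connect_of_new_cycle s_gt2 s_cycle).
apply/negP=> cs; apply: (T_acyclic s s_gt2).
by rewrite /ucycle cs; case/andP: s_cycle.
Qed.

(** Makes the denominator of [relative_resistance] nonzero. The tree is a maximal acyclic set above
    the empty one. *)
Lemma spanning_tree_exists (V : finType) (e : rel V) :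
  exists T : {set {set V}}, spanning_tree e T.
Proof.
have [|T sT _] := @maxset_exists _ (fun F => (F \subset edges e) && `[< acyclic F >]) set0.
  rewrite sub0set andTb; apply/asboolP; case=> [|x [|y s]] //= _.
  by rewrite /ucycle /= in_set0.
by exists T.
Qed.

(** * Edges that survive a map of the vertices *)

(** The non-loop edges of the image multigraph inside [S], kept as edges of [T] so that parallel
    ones count separately. *)
Definition surviving (V W : finType) (f : V -> W) (T : {set {set V}}) (S : {set W}) :
    {set {set V}} :=
  [set t in T | (f @: t \subset S) && (1 < #|f @: t|)%N].

(* Grow a subset of the image one point at a time, along an edge leaving it. *)
Lemma card_surviving (V W : finType) (f : V -> W) (T : {set {set V}}) :
  connected (adj T) -> (#|f @: V| <= #|surviving f T (f @: V)|.+1)%N.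
Proof.
move=> T_conn.
case: (pickP V) => [x0 _|V0]; last first.
  by apply: leq_trans (leq_imset_card f V) _; rewrite eq_card0.
suff grow n : (n < #|f @: V|)%N -> exists S : {set W},
    [/\ S \subset f @: V, f x0 \in S, #|S| = n.+1 & (n <= #|surviving f T S|)%N].
  have fV_gt0 : (0 < #|f @: V|)%N by apply/card_gt0P; exists (f x0); apply: imset_f.
  have [|S [SfV _ cS nS]] := grow #|f @: V|.-1; first by rewrite prednK.
  rewrite prednK // in cS.
  have /eqP <- : S == f @: V by rewrite eqEcard SfV cS /=.
  by rewrite cS -(prednK fV_gt0).
elim: n => [_|n IH lt_n].
  by exists [set f x0]; rewrite sub1set imset_f // set11 cards1.
have [S [SfV x0S cS nS]] := IH (ltnW lt_n).
have [w wfV wS] : exists2 w, w \in f @: V & w \notin S.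
  by apply/subsetPn; apply: contraTN lt_n => /subset_leq_card; rewrite cS -leqNgt.
case/imsetP: wfV wS => y _ -> yS.
have [a [b [abT aS bS]]] := connect_exit (P := fun x => f x \in S) (T_conn x0 y) x0S yS.
exists (f b |: S); split.
- by rewrite subUset SfV sub1set imset_f.
- by rewrite in_setU1 x0S orbT.
- by rewrite cardsU1 bS cS.
(* The edge from [a] to [b] is counted anew: [f b] lies outside [S], so it did not survive for
   [S]. *)
apply: (@leq_trans #|[set a; b] |: surviving f T S|).
  rewrite cardsU1.
  suff -> : [set a; b] \notin surviving f T S by rewrite add1n ltnS.
  rewrite inE imsetU1 imset_set1 subUset !sub1set (negbTE bS).
  by rewrite andbF /= andbF.
apply/subset_leq_card/subsetP=> t; rewrite in_setU1 => /orP[/eqP->|].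
  rewrite /adj in abT.
  rewrite inE abT imsetU1 imset_set1 subUset !sub1set !in_setU1 aS eqxx orbT /=.
  rewrite cards2; suff -> : f a != f b by [].
  by apply: contraNneq bS => <-.
rewrite !inE => /and3P[-> tS ->]; rewrite andbT /=.
exact: subset_trans tS (subsetUr _ _).
Qed.

(** * Contracting the components of the complement of [U] *)

(** Each component goes to its canonical root and [U] stays fixed, so the contracted graph lives on
    a subset of [V]. *)
Definition contract (V : finType) (e : rel V) (U : {set V}) (x : V) : V :=
  if insub x is Some z then val (fingraph.root (@delete_vertices V e U) z) else x.

Section Contract.

Variables (V : finType) (e : rel V) (U : {set V}).
Hypothesis e_sym : symmetric e.
Let D := @delete_vertices V e U.

Let D_sym : connect_sym D.
Proof. by apply: sym_connect_sym => x y; apply: e_sym. Qed.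

(** The image contains both [U] and the roots of the components, and these sets are disjoint. *)
Lemma card_contract : (#|U| + num_components D <= #|contract e U @: V|)%N.
Proof.
have <- : #|[set val z | z in roots D]| = num_components D.
  rewrite card_imset; last exact: val_inj.
  by apply: eq_card => z; rewrite !inE andbT.
set A := [set val z | z in roots D].
have UA0 : U :&: A = set0.
  apply/setP=> x; rewrite !inE; apply/andP=> -[xU /imsetP[z _ xz]].
  by have := valP z; rewrite /= -xz xU.
rewrite -cardsUI UA0 cards0 addn0.
apply/subset_leq_card; rewrite subUset; apply/andP; split.
  apply/subsetP=> x xU; apply/imsetP; exists x => //.
  by rewrite /contract insubF // xU.
apply/subsetP=> _ /imsetP[z zr ->]; apply/imsetP; exists (val z) => //.
by rewrite /contract valK (eqP zr).
Qed.

Lemma contract_edge (x y : V) :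
  e x y -> contract e U x != contract e U y -> (x \in U) || (y \in U).
Proof.
move=> exy; apply: contraNT; rewrite negb_or => /andP[xU yU].
rewrite /contract (insubT (fun x => x \notin U) xU) (insubT (fun x => x \notin U) yU).
by rewrite (inj_eq val_inj) root_connect // connect1.
Qed.

Lemma tree_degree_sum (T : {set {set V}}) :
  connected e -> spanning_tree e T ->
  (#|U| + num_components D <=
   (\sum_(v in U) \sum_(u | e u v) ([set u; v] \in T)).+1)%N.
Proof.
move=> e_conn T_tree.
apply: leq_trans card_contract _.
apply: leq_trans (card_surviving _ (spanning_tree_connected e_conn T_tree)) _.
(* The degree sum counts the pairs of a vertex [v] of [U] and a tree neighbour [u]. Each surviving
   edge comes from at least one such pair; an edge inside [U] comes from two. *)
rewrite ltnS pair_big_dep /= -big_mkcondr /= sum1_card.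
set P := (X in (_ <= #|X|)%N).
apply: leq_trans (leq_imset_card (fun p => [set p.2; p.1]) P).
apply/subset_leq_card/subsetP=> t; rewrite inE => /and3P[tT _ t_big].
have /imsetP[[x y] /= exy tE] := subsetP (spanning_tree_sub_edges T_tree) _ tT.
rewrite inE /= in exy.
have eyx : e y x by rewrite e_sym.
move: t_big; rewrite {1}tE imsetU1 imset_set1 cards2.
case: eqVneq => // /(contract_edge exy) /orP[xU|yU] _; apply/imsetP.
- by exists (x, y); [rewrite unfold_in /= xU eyx setUC -tE|rewrite setUC].
- by exists (y, x); first by rewrite unfold_in /= yU exy -tE.
Qed.

(** Rules out an empty cut, for which the sum of curvatures over [U] would not be positive. *)
Lemma delete_none_connected : U = set0 -> connected e -> connected D.
Proof.
move=> U0 e_conn x y.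
have /connectP[p] := e_conn (val x) (val y).
elim: p x => [|z p IH] x /=; first by move=> _ /val_inj ->.
case/andP=> exz zp yE.
have zU : z \notin U by rewrite U0 inE.
apply: connect_trans (IH (exist _ z zU) zp yE).
exact: connect1.
Qed.

End Contract.

(** * Relative resistance as an edge probability *)

Section ExpectedDegree.

Variables (R : realType) (V : finType) (e : rel V) (c : {set V} -> R).
Hypothesis c_gt0 : forall f, f \in edges e -> 0 < c f.

Let weight (T : {set {set V}}) : R := \prod_(t in T) c t.
Let total : R := \sum_(T | spanning_tree e T) weight T.

Let weight_gt0 T : spanning_tree e T -> 0 < weight T.
Proof.
move=> /spanning_tree_sub_edges/subsetP T_edges.
by apply: prodr_gt0 => t /T_edges; apply: c_gt0.
Qed.

Let total_gt0 : 0 < total.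
Proof.
have [T T_tree] := spanning_tree_exists e.
rewrite /total (bigD1 T) //= ltr_pwDl ?weight_gt0 //.
by apply: sumr_ge0 => T' /andP[/weight_gt0/ltW].
Qed.

(** By linearity of expectation the right-hand side is the weighted mean over spanning trees of a
    count that is at least [k] on each of them. *)
Lemma resistance_sum_ge (U : {set V}) (k : nat) :
  (forall T, spanning_tree e T ->
     (k <= \sum_(v in U) \sum_(u | e u v) ([set u; v] \in T))%N) ->
  k%:R <= \sum_(v in U) \sum_(u | e u v) relative_resistance e c [set u; v].
Proof.
move=> k_le.
have -> : \sum_(v in U) \sum_(u | e u v) relative_resistance e c [set u; v] =
    (\sum_(T | spanning_tree e T)
      weight T * (\sum_(v in U) \sum_(u | e u v) ([set u; v] \in T))%:R) / total.
  under [in RHS]eq_bigr => T _.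
    rewrite natr_sum mulr_sumr.
    under eq_bigr => v _ do rewrite natr_sum mulr_sumr.
    over.
  rewrite exchange_big mulr_suml; apply: eq_bigr => v _.
  rewrite exchange_big mulr_suml; apply: eq_bigr => u _.
  rewrite /relative_resistance big_mkcondr; congr (_ / _).
  by apply: eq_bigr => T _; case: (_ \in T); rewrite ?mulr1 ?mulr0.
rewrite ler_pdivlMr // mulr_sumr; apply: ler_sum => T T_tree.
by rewrite [X in X <= _]mulrC ler_pM2l ?weight_gt0 // ler_nat k_le.
Qed.

End ExpectedDegree.

Theorem theorem1p3 (R : realType) (V : finType) (e : rel V)
    (e_sym : symmetric e) (e_irr : irreflexive e)
    (e_conn : connected e) (e_rp : resistance_positive e R) :
  tough (1 : R) e.
Proof.
case: e_rp => c [c_gt0 p_gt0] U U_cuts.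
set m := num_components _.
have U_neq0 : U != set0.
  by apply/eqP=> U0; apply: U_cuts; apply: delete_none_connected.
have le_sum : (#|U| + m).-1%:R <=
    \sum_(v in U) \sum_(u | e u v) relative_resistance e c [set u; v].
  apply: resistance_sum_ge => // T T_tree.
  by have := tree_degree_sum U e_sym e_conn T_tree; rewrite -/m; case: (_ + m)%N.
have sum_p_gt0 : 0 < \sum_(v in U) resistance_curvature e c v.
  have [v vU] := set0Pn _ U_neq0.
  rewrite (bigD1 v) //= ltr_pwDl ?p_gt0 // sumr_ge0 // => w _.
  exact/ltW/p_gt0.
(* The sum of curvatures over [U] is [#|U|] minus half the sum of resistances. *)
have sum_lt : (#|U| + m).-1%:R < (#|U| + #|U|)%:R :> R.
  move: sum_p_gt0; rewrite /resistance_curvature sumrB -mulr_sumr sumr_const.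
  rewrite natrD; lra.
(* Over the integers the strict inequality absorbs the predecessor: [#|U| + m <= #|U| + #|U|]. *)
rewrite divr1 ler_nat -(leq_add2l #|U|).
by move: sum_lt; rewrite ltr_nat; case: (_ + m)%N.
Qed.
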